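(* Let $N\ge1$, $h=1/N$, $\eta\ge0$, and consider the generalized matrix eigenvalue problem of $C^3$-quartic softIGA with $N$ uniform elements on $[0,1]$, $$(\tilde K_4-\eta S_4)\hat U=\hat\lambda^h\tilde M_4\hat U,$$ with $\tilde K_4,\tilde M_4,S_4\in\mathbb R^{N\times N}$ as in the context. Its eigenpairs are $(\hat\lambda^h_j,\hat U_j)$, $j\in\{1,\dots,N\}$, where, with $t_j:=j\pi h$ and some normalization constants $c_j>0$, $$\hat\lambda^h_j=\frac{288\sin^2(\frac{t_j}2)}{h^2}\cdot\frac{1208-176400\eta+3(397+94080\eta)\cos(t_j)+\Lambda_\eta}{78095+88234\cos(t_j)+14608\cos(2t_j)+502\cos(3t_j)+\cos(4t_j)},$$ $$\Lambda_\eta=120(1-1176\eta)\cos(2t_j)+(1+40320\eta)\cos(3t_j)-5040\eta\cos(4t_j),$$ $$\hat U_j=c_j\big(\sin((k-\tfrac12)t_j)\big)_{k\in\{1,\dots,N\}}.$$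
   Context: $\tilde K_4,\tilde M_4,S_4$ are the matrices, in the (boundary-modified) B-spline basis of the space of $C^3$ piecewise quartics $w$ on the uniform mesh of $[0,1]$ with $w=w''=0$ at $0$ and $1$, of the bilinear forms $\int_0^1v'w'\,dx$, $\int_0^1 vw\,dx$, and $h^{7}\sum_{\text{interior nodes}}[\![v^{(4)}]\!][\![w^{(4)}]\!]+2h^7\big(v^{(4)}(0)w^{(4)}(0)+v^{(4)}(1)w^{(4)}(1)\big)$. Explicitly, they are symmetric and persymmetric $N\times N$ Toeplitz-plus-Hankel matrices $$A_{kl}=\sum_{m\in\mathbb Z}\big(a_{|k-l+2Nm|}-a_{|k+l-1+2Nm|}\big),\qquad 1\le k,l\le N,$$ with stencils (entries not listed are $0$): $\tilde K_4$: $(a_0,\dots,a_4)=\frac1h(\frac{35}{72},-\frac{11}{360},-\frac{17}{90},-\frac{59}{2520},-\frac1{5040})$; $\tilde M_4$: $(a_0,\dots,a_4)=h(\frac{15619}{36288},\frac{44117}{181440},\frac{913}{22680},\frac{251}{181440},\frac1{362880})$; $S_4$: $(a_0,\dots,a_5)=\frac1h(252,-210,120,-45,10,-1)$. For instance, for large $N$ the first row of $S_4$ is $\frac1h(462,-330,165,-55,11,-1,0,\dots)$. *)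

(* Defs.v *)
From HB Require Import structures.
From mathcomp Require Export all_boot all_order all_algebra.
From mathcomp Require Export all_classical all_reals all_analysis.

Set Implicit Arguments.
Unset Strict Implicit.
Unset Printing Implicit Defensive.

Import Order.TTheory GRing.Theory Num.Theory.

Local Open Scope classical_set_scope.
Local Open Scope ring_scope.

(* Decimal literals with a thousands separator: ring_scope numerals expand to
   unary naturals, which is intractable for numbers such as 362880. *)
Local Notation "a `, b" := (a * 1000 + b)
  (at level 39, left associativity, format "a `, b") : ring_scope.

(* The ordinals k, l : 'I_N stand for the 1-based indices k.+1, l.+1.  A stencil
   is a finite list, extended by 0, so for N >= 1 the sum over Z has finite
   support.  The terms with k + l - 1 and the 2N-periodization encode the odd
   reflections of the uniform B-splines at 0 and 1 (w = w'' = 0 there). *)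
Definition toeplitz_hankel (R : realType) (N : nat) (a : seq R) : 'M[R]_N :=
  \matrix_(k < N, l < N) \sum_(m \in [set: int])
    (a`_(absz (k.+1%:Z - l.+1%:Z + 2 * N%:Z * m))
     - a`_(absz (k.+1%:Z + l.+1%:Z - 1 + 2 * N%:Z * m))).

(* Stiffness, mass and jump-penalty matrices of the C^3 quartic B-splines. *)
Definition tildeK4 (R : realType) (N : nat) (h : R) : 'M[R]_N :=
  h^-1 *: toeplitz_hankel N
    [:: 35 / 72; - (11 / 360); - (17 / 90); - (59 / 2`,520); - (1 / 5`,040)].

Definition tildeM4 (R : realType) (N : nat) (h : R) : 'M[R]_N :=
  h *: toeplitz_hankel N
    [:: 15`,619 / 36`,288; 44`,117 / 181`,440; 913 / 22`,680; 251 / 181`,440; 1 / 362`,880].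

Definition S4 (R : realType) (N : nat) (h : R) : 'M[R]_N :=
  h^-1 *: toeplitz_hankel N [:: 252; - 210; 120; - 45; 10; - 1].

Definition Lambda_eta (R : realType) (eta t : R) : R :=
  120 * (1 - 1`,176 * eta) * cos (2 * t)
  + (1 + 40`,320 * eta) * cos (3 * t)
  - 5`,040 * eta * cos (4 * t).

Definition lambda_h (R : realType) (h eta t : R) : R :=
  288 * sin (t / 2) ^+ 2 / h ^+ 2
  * ((1`,208 - 176`,400 * eta + 3 * (397 + 94`,080 * eta) * cos t
      + Lambda_eta eta t)
     / (78`,095 + 88`,234 * cos t + 14`,608 * cos (2 * t) + 502 * cos (3 * t)
        + cos (4 * t))).

Definition gen_eigenpair (R : realType) (N : nat) (A B : 'M[R]_N)
    (lam : R) (u : 'cV[R]_N) : Prop :=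
  u != 0 /\ A *m u = lam *: (B *m u).

(* The family (lam j, U j) lists all generalized eigenpairs of (A, B), with
   multiplicity: the U j form a basis, and an arbitrary eigenpair (mu, u) has u
   in the span of the U j with lam j = mu.  (Eigenvectors can only be determined
   in this sense, since some of the lam j may coincide.) *)
Definition eigenpairs_are (R : realType) (N : nat) (A B : 'M[R]_N)
    (lam : 'I_N -> R) (U : 'I_N -> 'cV[R]_N) : Prop :=
  [/\ forall j, gen_eigenpair A B (lam j) (U j),
      basis_of {:'cV[R]_N} [tuple U j | j < N]
    & forall mu u, gen_eigenpair A B mu u ->
        exists x : 'I_N -> R, u = \sum_(j < N | lam j == mu) x j *: U j].

(* Main.v *)
(* Sampling s(z) = sin((z + 1/2) t) with N t a multiple of pi gives a sequence that
   is odd about -1/2 and 2N-periodic. Folding by these two symmetries turns the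
   Toeplitz-plus-Hankel product at s into a convolution on Z with the symmetric
   stencil, for which s is an eigenfunction with eigenvalue the cosine symbol. The
   stencil (0, 1) has the pairwise distinct eigenvalues 2 cos(t_j), so the sine
   vectors are independent and diagonalize all three matrices simultaneously. *)
Require Import Defs.
From mathcomp Require Import ring lra zify.
Set Implicit Arguments.
Unset Strict Implicit.
Unset Printing Implicit Defensive.

Import Order.TTheory GRing.Theory Num.Theory.

Local Open Scope classical_set_scope.
Local Open Scope ring_scope.

Local Notation "a `, b" := (a * 1000 + b)
  (at level 39, left associativity, format "a `, b") : ring_scope.

Local Notation stiffness_stencil :=
  [:: 35 / 72; - (11 / 360); - (17 / 90); - (59 / 2`,520); - (1 / 5`,040)].
Local Notation mass_stencil :=
  [:: 15`,619 / 36`,288; 44`,117 / 181`,440; 913 / 22`,680; 251 / 181`,440;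
      1 / 362`,880].
Local Notation penalty_stencil := [:: 252; - 210; 120; - 45; 10; - 1].

(** * Folding the integers by reflection and periodicity *)

Definition zrange (B : nat) : seq int := [seq i%:Z - B%:Z | i <- iota 0 (2 * B).+1].

Lemma zrange_uniq (B : nat) : uniq (zrange B).
Proof. by rewrite map_inj_uniq ?iota_uniq// => i j; lia. Qed.

Lemma mem_zrange (B : nat) (m : int) : (m \in zrange B) = (- B%:Z <= m <= B%:Z).
Proof.
apply/mapP/idP => [[i]|mB]; first by rewrite mem_iota => ? ->; lia.
by exists (absz (m + B%:Z)); rewrite ?mem_iota; lia.
Qed.

Lemma sum_pair_delta (R : pzRingType) (I : finType) (J : eqType) (r : seq J)
    (P : I -> J -> bool) (i0 : I) (j0 : J) :
    uniq r -> j0 \in r ->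
    (forall i j, P i j = (i == i0) && (j == j0)) ->
  \sum_i \sum_(j <- r) (P i j)%:R = 1 :> R.
Proof.
move=> ur rj0 PE; rewrite (bigD1 i0)//= (bigD1_seq j0)//= PE !eqxx big1 => [|j].
  rewrite big1 ?addr0// => i /negPf i0F.
  by rewrite big1// => j _; rewrite PE i0F.
by move=> /negPf j0F; rewrite PE eqxx j0F.
Qed.

Lemma periodic_int (V : zmodType) (s : int -> V) (T : int) :
  periodic s T -> forall z m : int, s (z + T * m) = s z.
Proof.
move=> sT z m.
have sTn (n : nat) x : s (x + T * n%:Z) = s x.
  by rewrite -[RHS](periodicn sT n); congr s; rewrite -mulr_natr natz.
case: m => [n|n]; first exact: sTn.
by rewrite -[LHS](sTn n.+1) NegzE; congr s; ring.
Qed.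

(** A nonzero multiple of [n] is too large to be cancelled by [e]. This yields uniqueness of the
    quotient modulo 2N. *)
Lemma mul_add_small_eq0 (n x e : int) : n * x + e = 0 -> - n < e < n -> x = 0.
Proof. by move=> eq0 en; have [x0|x0|//] := ltgtP x 0; exfalso; nia. Qed.

(* Every integer has exactly one of the forms l - 2Nm, -1 - l - 2Nm, for exactly one
   pair (l, m) with 0 <= l < N; the bound on y keeps m within [-B, B]. *)
Lemma sum_reflections (R : pzRingType) (N B : nat) (y : int) :
    (0 < N)%N -> - (2 * N%:Z * B%:Z) <= y < 2 * N%:Z * B%:Z ->
  \sum_(l < N) \sum_(m <- zrange B)
    ((l%:Z - 2 * N%:Z * m == y)%:R + (-1 - l%:Z - 2 * N%:Z * m == y)%:R) = 1 :> R.
Proof.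
move=> N0 yB.
under eq_bigr do rewrite big_split.
rewrite big_split/=.
have [q [p [yE p0 p2N]]] : exists q p : int, [/\ y = 2 * N%:Z * q + p, 0 <= p & p < 2 * N%:Z].
  exists (y %/ (2 * N%:Z))%Z, (y %% (2 * N%:Z))%Z.
  rewrite mulrC -divz_eq; split=> //; first by apply: modz_ge0; lia.
  by apply: ltz_pmod; lia.
have qB : - B%:Z <= q < B%:Z by apply/andP; split; nia.
(* The remainder decides the form: if p < N, then l = p and m = -q; otherwise l = 2N - 1 - p and m =
   -q - 1. *)
have [pN|Np] := ltP p N%:Z.
  have pN' : (absz p < N)%N by lia.
  rewrite (@sum_pair_delta _ _ _ _ _ (Ordinal pN') (- q)) ?zrange_uniq//.
  (* The reflected form cannot give y: 2N(q + m) + (p + l + 1) = 0 with 0 < p + l + 1 < 2N is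
     impossible. *)
  - rewrite big1 ?addr0// => l _; rewrite big1// => m _.
    have lN := ltn_ord l; case: eqP => // lE.
    have qm : q + m = 0.
      by apply: (@mul_add_small_eq0 (2 * N%:Z) _ (p + l%:Z + 1)); lia.
    have mE : m = - q by lia.
    by exfalso; subst m; lia.
  - by rewrite mem_zrange; lia.
  - move=> l m; rewrite -val_eqE/=; have lN := ltn_ord l.
    apply/eqP/andP => [lE|[/eqP lE /eqP ->]]; last by lia.
    have qm : q + m = 0.
      by apply: (@mul_add_small_eq0 (2 * N%:Z) _ (p - l%:Z)); lia.
    have mE : m = - q by lia.
    by subst m; split; apply/eqP; lia.
have pN' : (absz (2 * N%:Z - 1 - p)%R < N)%N by lia.
rewrite addrC (@sum_pair_delta _ _ _ _ _ (Ordinal pN') (- q - 1)) ?zrange_uniq//.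
- rewrite big1 ?addr0// => l _; rewrite big1// => m _.
  have lN := ltn_ord l; case: eqP => // lE.
  have qm : q + m = 0.
    by apply: (@mul_add_small_eq0 (2 * N%:Z) _ (p - l%:Z)); lia.
  have mE : m = - q by lia.
  by exfalso; subst m; lia.
- by rewrite mem_zrange; lia.
- move=> l m; rewrite -val_eqE/=; have lN := ltn_ord l.
  apply/eqP/andP => [lE|[/eqP lE /eqP ->]]; last by lia.
  have qm : q + m + 1 = 0.
    by apply: (@mul_add_small_eq0 (2 * N%:Z) _ (p + l%:Z + 1 - 2 * N%:Z)); lia.
  have mE : m = - q - 1 by lia.
  by subst m; split; apply/eqP; lia.
Qed.

(** The shifted index has size at least 2N(|m| - 1) + 1 >= |m|, so it falls outside a stencil of
    length [n]. Hence the sum over all integers [m] is finite. *)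
Lemma leq_absz_shift (n N : nat) (x m : int) :
    (absz x < 2 * N)%N -> (n < absz m)%N ->
  (n <= absz (x + 2 * N%:Z * m)%R)%N.
Proof.
move=> xN nm; have N1 : 1 <= N%:Z by lia.
have Nm : N%:Z * `|m| >= N%:Z + `|m| - 1.
  have m1 : 1 <= `|m| by lia.
  by move: N1 m1; clear; nia.
by have [m0|m0|m0] := ltgtP m 0; lia.
Qed.

(* The indices are 0-based: the reflections k -> 1 - k become z -> -1 - z. *)
Lemma toeplitz_hankel_mul (R : realType) (N : nat) (a : seq R) (s : int -> R)
    (k : 'I_N) :
    (forall z, s (-1 - z) = - s z) -> periodic s (2 * N%:Z) ->
  \sum_(l < N) toeplitz_hankel N a k l * s l%:Z =
  \sum_(d < size a) a`_d *
    (if d == 0 :> nat then s k%:Z else s (k%:Z - d%:Z) + s (k%:Z + d%:Z)).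
Proof.
move=> s_odd s_per.
have N0 : (0 < N)%N by apply: leq_ltn_trans (ltn_ord k).
have kN := ltn_ord k.
(* This radius is ample for two purposes: stencil terms outside it vanish, and it covers all
   reflections onto positions within [size a] of [0, N). *)
pose r := zrange (size a).+2.
(* Splitting by the distance [d] from [k] reduces the folding to indicator functions. *)
pose g (d : nat) (y : int) : R := (absz (k%:Z - y) == d)%:R * s y.
have aE (y : int) : a`_(absz (k%:Z - y)) * s y = \sum_(d < size a) a`_d * g d y.
  have [yl|ly] := ltnP (absz (k%:Z - y)) (size a).
    rewrite (bigD1 (Ordinal yl))//= /g eqxx mul1r big1 ?addr0// => d.
    by rewrite -val_eqE/= eq_sym => /negPf ->; rewrite mul0r mulr0.
  rewrite nth_default// mul0r big1// => d _; rewrite /g.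
  by case: eqP => [yd|_]; [have := ltn_ord d; lia|rewrite mul0r mulr0].
have -> : \sum_(l < N) toeplitz_hankel N a k l * s l%:Z =
    \sum_(l < N) \sum_(m <- r) \sum_(d < size a) a`_d *
      (g d (l%:Z - 2 * N%:Z * m) + g d (-1 - l%:Z - 2 * N%:Z * m)).
  apply: eq_bigr => l _; have lN := ltn_ord l.
  rewrite mxE (fsbigE r) ?zrange_uniq//; last first.
    move=> m _; rewrite mem_zrange => mr.
    have mB : (size a < absz m)%N by move: (m : int) mr => {}m mr; lia.
    by rewrite !nth_default ?subr0// leq_absz_shift//; lia.
  rewrite big_mkcond/= mulr_suml; apply: eq_bigr => m _; rewrite in_setT.
  under eq_bigr do rewrite mulrDr.
  rewrite big_split/= -!aE mulrBl.
  (* Periodicity and oddness give s(-1 - l - 2Nm) = -s(l), which absorbs the minus sign of the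
     Hankel term. *)
  have sE (z : int) : s (z - 2 * N%:Z * m) = s z by rewrite -mulrN periodic_int.
  rewrite !sE s_odd mulrN.
  by congr (a`_(absz _) * _ - a`_(absz _) * _); lia.
under eq_bigr do rewrite exchange_big.
rewrite exchange_big; apply: eq_bigr => d _ /=.
under eq_bigr do rewrite -mulr_sumr.
rewrite -mulr_sumr; congr (_ * _); have da := ltn_ord d.
have sumE (y : int) : - (size a)%:Z <= y < N%:Z + (size a)%:Z ->
    \sum_(l < N) \sum_(m <- r) ((l%:Z - 2 * N%:Z * m == y)%:R * s y
      + (-1 - l%:Z - 2 * N%:Z * m == y)%:R * s y) = s y.
  move=> yB; rewrite -[RHS]mul1r -[X in _ = X * _](@sum_reflections R N (size a).+2 y)//; last by nia.
  rewrite mulr_suml; apply: eq_bigr => l _.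
  by rewrite mulr_suml; apply: eq_bigr => m _; rewrite [RHS]mulrDl.
case: eqP => d0.
  rewrite -[RHS]sumE; last lia.
  have gE y : g d y = (y == k%:Z)%:R * s k%:Z.
    rewrite /g; have [->|/eqP yk] := eqVneq y k%:Z.
      by rewrite subrr d0 eqxx.
    by rewrite (_ : (_ == _) = false) ?mul0r//; apply/eqP; lia.
  by under eq_bigr do under eq_bigr do rewrite !gE.
(* For d > 0 the positions k - d and k + d are distinct, so their indicators do not overlap; for d =
   0 they would count [k] twice. *)
have gE y : g d y = (y == k%:Z - d%:Z)%:R * s (k%:Z - d%:Z)
                    + (y == k%:Z + d%:Z)%:R * s (k%:Z + d%:Z).
  rewrite /g; have [->|/eqP ykd] := eqVneq y (k%:Z - d%:Z).
    rewrite [(k%:Z - d%:Z) == _](_ : _ = false); last by apply/eqP; lia.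
    by rewrite mul0r addr0 (_ : (_ == _) = true)//; apply/eqP; lia.
  rewrite mul0r add0r; have [->|/eqP ykd'] := eqVneq y (k%:Z + d%:Z).
    by rewrite (_ : (_ == _) = true)//; apply/eqP; lia.
  by rewrite (_ : (_ == _) = false) ?mul0r//; apply/eqP; lia.
rewrite -[in RHS]sumE; last lia.
rewrite -[X in _ = _ + X]sumE; last lia.
rewrite -big_split; apply: eq_bigr => l _.
by rewrite -big_split; apply: eq_bigr => m _; rewrite /= !gE addrACA.
Qed.

(** * Cosine symbols and sine eigenvectors *)

Definition stencil_symbol (R : realType) (a : seq R) (t : R) : R :=
  \sum_(d < size a) a`_d * (if d == 0 :> nat then 1 else 2 * cos (d%:R * t)).

Definition sine_col (R : realType) (N : nat) (t : R) : 'cV[R]_N :=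
  \col_(k < N) sin ((k.+1%:R - 1 / 2) * t).

(** A shift by 2N adds 2Nt = 2 j pi to the argument of the sine, hence the period. The symbol then
    comes from sin(x - dt) + sin(x + dt) = 2 cos(dt) sin x. *)
Lemma toeplitz_hankel_sine (R : realType) (N j : nat) (a : seq R) (t : R) :
    N%:R * t = j%:R * pi ->
  toeplitz_hankel N a *m sine_col N t = stencil_symbol a t *: sine_col N t.
Proof.
move=> Nt; pose s (z : int) : R := sin ((z%:~R + 1 / 2) * t).
have s_odd z : s (-1 - z) = - s z.
  by rewrite /s -sinN rmorphB/= rmorphN1; congr sin; field.
have s_per : periodic s (2 * N%:Z).
  move=> z; rewrite /s -[RHS](periodicn (@sinD2pi R) j) rmorphD rmorphM/=.
  congr sin; rewrite -pmulrn -mulrnA -[X in _ = _ + X]mulr_natr natrM.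
  rewrite [RHS](_ : _ = (z%:~R + 1 / 2) * t + 2 * (j%:R * pi)); last by ring.
  by rewrite -Nt; ring.
have sE (k : 'I_N) : sine_col N t k 0 = s k%:Z.
  by rewrite mxE /s -pmulrn; congr sin; rewrite -natr1; field.
apply/colP => k; rewrite !mxE -/(sine_col _ _ _ _).
under eq_bigr do rewrite sE.
rewrite toeplitz_hankel_mul// mulr_suml; apply: eq_bigr => d _.
rewrite -mulrA; congr (_ * _).
have -> : sin ((k.+1%:R - 1 / 2) * t) = s k%:Z by rewrite -sE mxE.
case: eqP => d0; first by rewrite mul1r.
rewrite /s rmorphB rmorphD/= -!pmulrn.
have -> : (k%:R - d%:R + 1 / 2) * t = (k%:R + 1 / 2) * t - d%:R * t by ring.
have -> : (k%:R + d%:R + 1 / 2) * t = (k%:R + 1 / 2) * t + d%:R * t by ring.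
by rewrite sinB sinD; ring.
Qed.

(** * Independence of eigenvectors and diagonal pencils *)

Lemma free_eigenvectors (F : fieldType) (n m : nat) (T : 'M[F]_n)
    (tau : 'I_m -> F) (V : 'I_m -> 'cV[F]_n) :
    injective tau -> (forall j, V j != 0) ->
    (forall j, T *m V j = tau j *: V j) ->
  free [tuple V j | j < m].
Proof.
move=> tau_inj V0 TV; apply/freeP => k kV i.
(* [eigenspace] consists of row vectors, hence the transposes. In a direct sum, 0 decomposes only
   trivially. *)
have dx : mxdirect (\sum_i eigenspace T^T (tau i)).
  by apply: mxdirect_sum_eigenspace => ? ? _ _; exact: tau_inj.
have [C _ _ uniqC] := sub_dsumsmx dx (sub0mx 1 _).
have C0 : C i = 0.
  by rewrite -(uniqC (fun=> 0)) ?big1// => *; rewrite sub0mx.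
have : (k i *: V i)^T = 0.
  rewrite -C0 (uniqC (fun j => (k j *: V j)^T))// => [j _|].
    by apply/eigenspaceP; rewrite -trmx_mul -scalemxAr TV -[RHS]linearZ/= !scalerA mulrC.
  rewrite -linear_sum/= -[LHS]trmx0; congr (_^T).
  rewrite -[LHS]kV; apply: eq_bigr => j _.
  by rewrite -tnth_nth tnth_mktuple.
by move=> /(congr1 trmx) /eqP; rewrite trmxK trmx0 scaler_eq0 (negPf (V0 i)) orbF => /eqP.
Qed.

(** In a common eigenbasis the pencil is diagonal: the coordinates of an eigenvector satisfy y_j
    (alpha_j - mu beta_j) = 0, so y_j vanishes unless alpha_j / beta_j = mu. *)
Lemma eigenpairs_are_diag (R : realType) (N : nat) (A B : 'M[R]_N)
    (alpha beta : 'I_N -> R) (V : 'I_N -> 'cV[R]_N) :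
    (forall j, A *m V j = alpha j *: V j) ->
    (forall j, B *m V j = beta j *: V j) ->
    (forall j, beta j != 0) -> free [tuple V j | j < N] ->
  eigenpairs_are A B (fun j => alpha j / beta j) V.
Proof.
move=> AV BV beta0 freeV.
have VE (j : 'I_N) : [tuple V j | j < N]`_j = V j by rewrite -tnth_nth tnth_mktuple.
have basisV : basis_of {:'cV[R]_N} [tuple V j | j < N].
  by rewrite basisEfree freeV subvf size_tuple dimvf /dim/= muln1 leqnn.
split=> // [j|mu u [_ ABu]].
  split; last by rewrite AV BV scalerA divfK.
  apply: (free_not0 freeV); rewrite -VE mem_nth// size_tuple; exact: ltn_ord.
have uE := coord_basis basisV (memvf u).
pose y j := coord [tuple V j | j < N] j u.
have {}uE : u = \sum_j y j *: V j.
  by rewrite [LHS]uE; apply: eq_bigr => j _; rewrite VE.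
have y0 j : y j * (alpha j - mu * beta j) = 0.
  move/freeP : freeV => /(_ (fun j => y j * (alpha j - mu * beta j))); apply.
  move/eqP : ABu; rewrite -subr_eq0 uE !mulmx_sumr scaler_sumr -sumrB => /eqP ABu0.
  rewrite -[RHS]ABu0; apply: eq_bigr => i _.
  rewrite VE -!scalemxAr AV BV !scalerA -scalerBl.
  by congr (_ *: _); ring.
exists y; rewrite uE [RHS]big_mkcond; apply: eq_bigr => j _ /=.
case: ifPn => // ab; have /eqP := y0 j; rewrite mulf_eq0 => /orP[/eqP->|].
  by rewrite scale0r.
by rewrite subr_eq0 => /eqP amu; rewrite amu mulfK ?eqxx in ab.
Qed.

(** * Closed forms of the symbols via Chebyshev polynomials *)

Lemma cos_natM_rec (R : realType) (n : nat) (t : R) :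
  cos (n.+2%:R * t) = 2 * cos t * cos (n.+1%:R * t) - cos (n%:R * t).
Proof.
have -> : n.+2%:R * t = n.+1%:R * t + t by rewrite -[in LHS]natr1; ring.
have -> : n%:R * t = n.+1%:R * t - t by rewrite -natr1; ring.
by rewrite cosD cosB; ring.
Qed.

Lemma cos_multiples (R : realType) (t : R) (c := cos t) :
  [/\ cos (2 * t) = 2 * c ^+ 2 - 1, cos (3 * t) = 4 * c ^+ 3 - 3 * c,
      cos (4 * t) = 8 * c ^+ 4 - 8 * c ^+ 2 + 1
    & cos (5 * t) = 16 * c ^+ 5 - 20 * c ^+ 3 + 5 * c].
Proof. by rewrite !cos_natM_rec !mul1r mul0r cos0 -/c; split; ring. Qed.

Definition mass_denominator (R : realType) (t : R) : R :=
  78`,095 + 88`,234 * cos t + 14`,608 * cos (2 * t) + 502 * cos (3 * t)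
  + cos (4 * t).

Lemma mass_denominator_gt0 (R : realType) (t : R) : 0 < mass_denominator t.
Proof.
rewrite /mass_denominator; have [-> -> -> _] := cos_multiples t.
set c := cos t; have : 0 <= 1 + c by have := cos_geN1 t; rewrite -/c; lra.
set x := 1 + c => x0; have -> : c = x - 1 by rewrite /x; ring.
(* Expanded at cos t = -1, all coefficients are positive. *)
have -> : 78`,095 + 88`,234 * (x - 1) + 14`,608 * (2 * (x - 1) ^+ 2 - 1)
   + 502 * (4 * (x - 1) ^+ 3 - 3 * (x - 1))
   + (8 * (x - 1) ^+ 4 - 8 * (x - 1) ^+ 2 + 1)
   = 3`,968 + 34`,304 * x + 23`,232 * x ^+ 2 + 1`,976 * x ^+ 3 + 8 * x ^+ 4 :> R.
  by ring.
have x2 := exprn_ge0 2 x0; have x3 := exprn_ge0 3 x0.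
by have x4 := exprn_ge0 4 x0; lra.
Qed.

(** The common denominator is 181440 = 9!/2, because each off-diagonal entry counts twice. *)
Lemma mass_symbolE (R : realType) (t : R) :
  stencil_symbol mass_stencil t = mass_denominator t / 181`,440.
Proof.
rewrite /stencil_symbol /mass_denominator !big_ord_recr big_ord0 /= !mul1r.
by field.
Qed.

Lemma mass_symbol_neq0 (R : realType) (t : R) : stencil_symbol mass_stencil t != 0.
Proof.
rewrite mass_symbolE mulf_eq0 negb_or (gt_eqF (mass_denominator_gt0 t)) /=.
by rewrite invr_eq0; apply: lt0r_neq0; lra.
Qed.

(** With sin^2(t/2) = (1 - cos t)/2, both sides become polynomials of degree at most five in cos
    t. *)
Lemma stiffness_penalty_symbolE (R : realType) (eta t : R) :
  stencil_symbol stiffness_stencil t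
  - eta * stencil_symbol penalty_stencil t =
  288 * sin (t / 2) ^+ 2
    * (1`,208 - 176`,400 * eta + 3 * (397 + 94`,080 * eta) * cos t
       + Lambda_eta eta t) / 181`,440.
Proof.
have -> : sin (t / 2) ^+ 2 = (1 - cos t) / 2.
  rewrite -[in RHS](@divfK _ 2 _ t)// mulr_natr cos_mulr2n cos2sin2.
  by field.
rewrite /stencil_symbol /Lambda_eta !big_ord_recr !big_ord0 /= !mul1r.
have [-> -> -> ->] := cos_multiples t.
by field.
Qed.

(** * Simultaneous diagonalization of the softIGA matrices *)

Theorem lemma5 (R : realType) (N : nat) (h eta : R) (c : 'I_N -> R)
    (hN : (1 <= N)%N) (hh : h = 1 / N%:R) (heta : 0 <= eta)
    (hc : forall j, 0 < c j) :
  let t (j : 'I_N) : R := j.+1%:R * pi * h in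
  eigenpairs_are (tildeK4 N h - eta *: S4 N h) (tildeM4 N h)
    (fun j => lambda_h h eta (t j))
    (fun j => c j *: \col_(k < N) sin ((k.+1%:R - 1 / 2) * t j)).
Proof.
move=> t.
have N0 : N%:R != 0 :> R by rewrite pnatr_eq0 -lt0n.
have h0 : h != 0 by rewrite hh mul1r invr_eq0.
have Nt j : N%:R * t j = j.+1%:R * pi by rewrite /t hh; field.
have t_gt0 j : 0 < t j.
  by rewrite -(pmulr_rgt0 _ (_ : 0 < N%:R)) ?ltr0n// Nt mulr_gt0 ?pi_gt0 ?ltr0n.
have t_lepi j : t j <= pi.
  by rewrite -(ler_pM2l (_ : 0 < N%:R)) ?ltr0n// Nt ler_wpM2r ?pi_ge0// ler_nat.
have c0 j : c j != 0 by rewrite gt_eqF.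
have sine0 j : sine_col N (t j) != 0.
  (* The first entry is sin(t_j / 2), positive because 0 < t_j <= pi. *)
  apply/eqP => /colP /(_ (Ordinal hN)); rewrite !mxE /= => /eqP; apply/negP.
  by rewrite gt_eqF// sin_gt0_pi//; have := t_gt0 j; have := t_lepi j; lra.
have symbolE a j : toeplitz_hankel N a *m (c j *: sine_col N (t j)) =
    stencil_symbol a (t j) *: (c j *: sine_col N (t j)).
  by rewrite -scalemxAr (toeplitz_hankel_sine _ (Nt j)) !scalerA mulrC.
(* As a quotient of symbols, the factor 181440 cancels and the scalings 1/h and h leave 1/h^2. *)
rewrite (_ : (fun j => lambda_h h eta (t j)) = fun j =>
  h^-1 * (stencil_symbol stiffness_stencil (t j)
          - eta * stencil_symbol penalty_stencil (t j))
  / (h * stencil_symbol mass_stencil (t j))); last first.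
  apply/funext => j; rewrite stiffness_penalty_symbolE mass_symbolE /lambda_h.
  rewrite -/(mass_denominator (t j)).
  have := lt0r_neq0 (mass_denominator_gt0 (t j)).
  move: (mass_denominator _) (Lambda_eta _ _) (sin _) (cos _) => D L s x D0.
  by field; rewrite D0 h0.
apply: eigenpairs_are_diag => [j|j|j|].
- rewrite mulmxBl /tildeK4 /S4 -!scalemxAl !symbolE !scalerA -scalerBl.
  by congr (_ *: _); ring.
- by rewrite /tildeM4 -scalemxAl symbolE scalerA.
- by rewrite mulf_eq0 negb_or h0 mass_symbol_neq0.
(* The values of [lambda_h] may coincide, whereas the symbol 2 cos t of this stencil is injective on
   [0, pi]. *)
- apply: (@free_eigenvectors _ _ _ (toeplitz_hankel N [:: 0; 1])
    (fun j => stencil_symbol [:: 0; 1] (t j))) => [i j|j|j] /=.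
  + rewrite /stencil_symbol !big_ord_recr !big_ord0 /= !mul0r !mul1r !add0r.
    have two0 : 2 != 0 :> R by rewrite pnatr_eq0.
    move=> /(mulfI two0) /cos_inj tij.
    have {}tij : t i = t j by apply: tij; rewrite in_itv/= ltW ?t_lepi.
    apply/val_inj/succn_inj/eqP; rewrite -(eqr_nat R); apply/eqP.
    by apply: (mulIf (lt0r_neq0 (pi_gt0 R))); rewrite -!Nt tij.
  + by rewrite scaler_eq0 negb_or c0 sine0.
  + exact: symbolE.
Qed.
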